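(* Let $G$ be a nontrivial graph of order $n$. Then $\gamma_{rdR}(G)\le 2\gamma_{rR}(G)-1$. Moreover, if $\gamma_{rdR}(G)=2\gamma_{rR}(G)-1$, then one of the following holds: (i) $G$ consists of a $K_2$ and $n-2$ isolated vertices; or (ii) $G$ consists of a vertex $h$ and two disjoint vertex sets $H$ and $R$ (that is, $V(G)$ is the disjoint union of $\{h\}$, $H$ and $R$) such that $H=N(h)$, $G[H]$ has no isolated vertices, $G[R]$ is trivial, there is no edge between $h$ and $R$, and $N(h)\cap N(R)\ne N(h)$.
   Context: All graphs are finite and simple. A graph is called trivial if it has no edges (i.e. it is $\overline{K_n}$), and nontrivial otherwise. $N(v)$ is the open neighborhood of $v$, and $N(R)=\bigcup_{v\in R}N(v)$. A restrained double Roman dominating function (RDRD function) of a graph $G$ is a function $f:V(G)\to\{0,1,2,3\}$ such that, with $V_i=\{v\in V(G): f(v)=i\}$: (a) every vertex $v\in V_0$ has at least two neighbors in $V_2$ or at least one neighbor in $V_3$; (b) every vertex $v\in V_1$ has at least one neighbor in $V_2\cup V_3$; (c) the induced subgraph $G[V_0]$ has no isolated vertex. The weight of $f$ is $\sum_{v\in V(G)} f(v)$, and $\gamma_{rdR}(G)$ is the minimum weight of an RDRD function of $G$. A restrained Roman dominating function of $G$ is a function $g:V(G)\to\{0,1,2\}$ such that every vertex $v$ with $g(v)=0$ has a neighbor $w$ with $g(w)=2$, and the subgraph induced by $\{v: g(v)=0\}$ has no isolated vertex. $\gamma_{rR}(G)$ is the minimum weight $\sum_{v} g(v)$ of such a function.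 *)

(* Defs.v *)
From mathcomp Require Import all_boot.

Set Implicit Arguments.
Unset Strict Implicit.
Unset Printing Implicit Defensive.

(* A finite simple graph is a symmetric irreflexive relation [e] on a finType
   of vertices; both properties are hypotheses of the theorem. *)

Section RestrainedDomination.

Variables (T : finType) (e : rel T).

Definition nbh (v : T) : {set T} := [set w | e v w].

Definition nbhs (A : {set T}) : {set T} := \bigcup_(v in A) nbh v.

(* The induced subgraph on [A] has no edges. *)
Definition trivial_on (A : {set T}) : bool :=
  [forall v in A, forall w in A, ~~ e v w].

(* The induced subgraph on [A] has no isolated vertex. *)
Definition no_isolated_on (A : {set T}) : bool :=
  [forall v in A, exists w in A, e v w].

Definition isolated (v : T) : bool := nbh v == set0.

(* [level f i] is V_i; functions V(G) -> {0, ..., k-1} are finite functions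
   into 'I_k. *)
Definition level (k : nat) (f : {ffun T -> 'I_k}) (i : nat) : {set T} :=
  [set v | f v == i :> nat].

Definition weight (k : nat) (f : {ffun T -> 'I_k}) : nat :=
  \sum_(v : T) f v.

Definition RDRD (f : {ffun T -> 'I_4}) : bool :=
  [&& [forall v in level f 0,
         (1 < #|nbh v :&: level f 2|) || (0 < #|nbh v :&: level f 3|)],
      [forall v in level f 1, 0 < #|nbh v :&: (level f 2 :|: level f 3)|]
    & no_isolated_on (level f 0)].

Definition RRD (g : {ffun T -> 'I_3}) : bool :=
  [forall v in level g 0, exists w in level g 2, e v w]
  && no_isolated_on (level g 0).

Definition const2 (k : nat) (lt2k : 2 < k) : {ffun T -> 'I_k} :=
  [ffun=> Ordinal lt2k].

(* The constant function 2 is always admissible (RDRD_const2 and RRD_const2),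
   so the minima below never fall back on a default value. *)
Definition gamma_rdR : nat :=
  weight [arg min_(f < @const2 4 isT | RDRD f) weight f].

Definition gamma_rR : nat :=
  weight [arg min_(g < @const2 3 isT | RRD g) weight g].

Lemma level_const2 k (lt2k : 2 < k) i :
  i != 2 -> level (const2 lt2k) i = set0.
Proof.
by move=> i2; apply/setP=> v; rewrite !inE ffunE /= eq_sym (negPf i2).
Qed.

Lemma RDRD_const2 : RDRD (@const2 4 isT).
Proof.
rewrite /RDRD /no_isolated_on (@level_const2 4 isT 0) ?(@level_const2 4 isT 1) //.
by apply/and3P; split; apply/forall_inP=> v; rewrite inE.
Qed.

Lemma RRD_const2 : RRD (@const2 3 isT).
Proof.
rewrite /RRD /no_isolated_on level_const2 //.
by apply/andP; split; apply/forall_inP=> v; rewrite inE.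
Qed.

Lemma gamma_rdR_spec :
  (exists2 f, RDRD f & weight f = gamma_rdR)
  /\ (forall f, RDRD f -> gamma_rdR <= weight f).
Proof.
rewrite /gamma_rdR; case: arg_minnP; first exact: RDRD_const2.
by move=> f Hf minf; split=> //; exists f.
Qed.

Lemma gamma_rR_spec :
  (exists2 g, RRD g & weight g = gamma_rR)
  /\ (forall g, RRD g -> gamma_rR <= weight g).
Proof.
rewrite /gamma_rR; case: arg_minnP; first exact: RRD_const2.
by move=> g Hg ming; split=> //; exists g.
Qed.

End RestrainedDomination.

(* Main.v *)
Require Import Defs.
From mathcomp Require Import all_boot zify.

Set Implicit Arguments.
Unset Strict Implicit.
Unset Printing Implicit Defensive.

(* Let g be a minimum restrained Roman dominating function. The map 0 -> 0,
   1 -> 2, 2 -> 3 turns g into an RDRD function of weight 2 w(g) - |W_2|, and a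
   vertex of weight 2 = 1 + 1 may be lowered to 1 whenever it keeps a positive
   neighbour that is not itself lowered. If W_2 is empty, then g is constantly
   1, and two vertices could be lowered unless the graph has a single edge. If
   W_2 = {h}, then no vertex may be lowered, so that W_1 is independent and
   avoids N(h) = W_0; if moreover each vertex of W_0 had a neighbour in W_1,
   then 2 would suffice on h. *)

Section RestrainedDominationBounds.

Variables (T : finType) (e : rel T).

(** Lets candidate functions be given by plain arithmetic formulas: the passage to ordinals and to
    cardinalities of neighbourhoods is made once, here. *)
Lemma gamma_rdR_le (F : T -> nat) :
    (forall v, F v < 4) ->
    (forall v, F v = 0 ->
       (exists2 x, e v x & F x = 3) \/
       (exists x y, [/\ x != y, e v x, e v y, F x = 2 & F y = 2])) ->
    (forall v, F v = 1 -> exists2 x, e v x & 1 < F x) ->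
    (forall v, F v = 0 -> exists2 w, e v w & F w = 0) ->
  gamma_rdR e <= \sum_v F v.
Proof.
move=> F4 F0 F1 FR; pose f : {ffun T -> 'I_4} := [ffun v => inord (F v)].
have fE v : f v = F v :> nat by rewrite ffunE inordK.
have levE i v : (v \in level f i) = (F v == i) by rewrite inE fE.
have -> : \sum_v F v = weight f by apply: eq_bigr => v _; rewrite fE.
have [_ ] := gamma_rdR_spec e; apply; apply/and3P; split; apply/forall_inP=> v.
- rewrite levE => /eqP/F0[[x vx x3]|[x [y [xy vx vy x2 y2]]]]; apply/orP.
    right; apply/card_gt0P; exists x.
    by rewrite inE levE x3 inE vx.
  left; apply/card_gt1P; exists x, y.
  by split=> //; rewrite inE levE ?x2 ?y2 inE ?vx ?vy.
- rewrite levE => /eqP/F1[x vx x2]; apply/card_gt0P; exists x.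
  rewrite inE in_setU !levE inE vx /=.
  by have := F4 x; lia.
- rewrite levE => /eqP/FR[w vw w0]; apply/exists_inP; exists w => //.
  by rewrite levE w0.
Qed.

Lemma RRD_dominated (g : {ffun T -> 'I_3}) v :
  RRD e g -> g v = 0 :> nat -> exists2 w, e v w & g w = 2 :> nat.
Proof.
case/andP=> /forall_inP g0 _ gv.
have /g0/exists_inP[w] : v \in level g 0 by rewrite inE gv.
by rewrite inE => /eqP; exists w.
Qed.

Lemma RRD_restrained (g : {ffun T -> 'I_3}) v :
  RRD e g -> g v = 0 :> nat -> exists2 w, e v w & g w = 0 :> nat.
Proof.
case/andP=> _ /forall_inP g0 gv.
have /g0/exists_inP[w] : v \in level g 0 by rewrite inE gv.
by rewrite inE => /eqP; exists w.
Qed.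

Lemma sum_mem (A : {set T}) : \sum_v (v \in A) = #|A|.
Proof. by rewrite -big_mkcond sum1_card. Qed.

(** [L] is the set of lowered vertices. The neighbour required outside [L] has positive value under
    [g], so it ends with weight at least 2 and dominates the lowered vertex. *)
Lemma gamma_rdR_lower (g : {ffun T -> 'I_3}) (L : {set T}) :
    RRD e g ->
    (forall v, v \in L ->
       g v = 1 :> nat /\ exists2 x, e v x & (x \notin L) && (0 < g x)) ->
  gamma_rdR e + #|L| + #|level g 2| <= 2 * weight g.
Proof.
move=> Hg HL.
(* The truncated subtraction is harmless: on [L] the value of [g] is 1, so [F] is 2 - 1 there. *)
pose F v := (if g v == 0 :> nat then 0 else (g v).+1) - (v \in L).
have g3 v : g v < 3 by [].
have L1 v : v \in L -> g v = 1 :> nat by case/HL.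
have FE v : F v + (v \in L) + (v \in level g 2) = 2 * g v.
  rewrite /F inE; have := g3 v; case: (boolP (v \in L)) => [/L1->//|_].
  by case: (nat_of_ord (g v)) => [|[|[|]]].
have F0 v : F v = 0 -> g v = 0 :> nat.
  have := FE v; rewrite inE.
  by case: (boolP (v \in L)) => [/L1->//|_]; lia.
have g0F v : g v = 0 :> nat -> F v = 0 by have := FE v; lia.
have -> : 2 * weight g = \sum_v F v + #|L| + #|level g 2|.
  rewrite -!sum_mem -!big_split /weight big_distrr /=.
  by apply: eq_bigr => v _; rewrite FE.
rewrite !leq_add2r; apply: gamma_rdR_le => v.
- by rewrite /F; have := g3 v; case: ifP => _; lia.
- move/F0/(RRD_dominated Hg) => [w vw w2]; left; exists w => //.
  have wL : w \notin L by apply/negP=> /L1; rewrite w2.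
  by rewrite /F w2 (negPf wL).
- move=> F1; have /HL[_ [x vx /andP[xL x0]]] : v \in L.
    have := FE v; rewrite F1 inE; case: (v \in L) => //=.
    by case: eqP => [->|]; lia.
  exists x => //; rewrite /F (negPf xL).
  by case: eqP; lia.
- by case/F0/(RRD_restrained Hg) => w vw w0; exists w => //; apply: g0F.
Qed.

End RestrainedDominationBounds.

Theorem theorem17 (T : finType) (e : rel T) (n : nat)
    (e_sym : symmetric e) (e_irr : irreflexive e)
    (order_n : #|T| = n) (nontrivial : ~~ trivial_on e [set: T]) :
  gamma_rdR e <= 2 * gamma_rR e - 1
  /\ (gamma_rdR e = 2 * gamma_rR e - 1 ->
      (exists u v : T,
         [/\ e u v,
             #|~: [set u; v]| = n - 2
           & forall w : T, w \in ~: [set u; v] -> isolated e w])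
      \/
      (exists (h : T) (H R : {set T}),
         [/\ [/\ h \notin H, h \notin R, [disjoint H & R]
               & [set: T] = [set h] :|: H :|: R],
             H = nbh e h,
             no_isolated_on e H,
             trivial_on e R
           & (forall r : T, r \in R -> ~~ e h r)
             /\ nbh e h :&: nbhs e R != nbh e h])).
Proof.
have [[g Hg gE] _] := gamma_rR_spec e.
have [u [v uv]] : exists u v, e u v.
  move: nontrivial; rewrite negb_forall_in => /exists_inP[u _].
  by rewrite negb_forall_in => /exists_inP[v _ /negPn]; exists u, v.
have neq_e x y : e x y -> x != y.
  by move=> xy; apply/eqP=> E; rewrite E e_irr in xy.
have lower L := gamma_rdR_lower (L := L) Hg; rewrite gE in lower.
have g3 w : g w < 3 by [].
case: (posnP #|level g 2|) => [/eqP|W2].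
  rewrite cards_eq0 => /eqP W2.
  have g1 w : g w = 1 :> nat.
    have n2 x : g x <> 2 :> nat.
      by move=> x2; have := in_set0 x; rewrite -W2 inE x2.
    have n0 : g w <> 0 :> nat by move=> /(RRD_dominated Hg)[x _ /n2].
    by have := g3 w; have := n2 w; lia.
  rewrite W2 cards0 in lower.
  (* The edge supplied by nontriviality lets [v] be lowered, since [u] keeps weight 2. *)
  have le1 : gamma_rdR e + 1 <= 2 * gamma_rR e.
    have := lower [set v]; rewrite cards1 addn0; apply=> w /set1P->.
    split=> //; exists u; first by rewrite e_sym.
    by rewrite inE g1 neq_e.
  split; first by lia.
  move=> eqg; left; exists u, v; split=> //.
    by have := cardsC [set u; v]; rewrite cards2 neq_e //; lia.
  move=> w; rewrite !inE negb_or => /andP[wu wv].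
  apply/negPn/negP=> /set0Pn[x]; rewrite inE => wx.
  (* An edge at [w], outside the edge [u v], should allow two vertices to be lowered at once, one
     more than equality permits. *)
  suff [L L2 HL] : exists2 L : {set T}, #|L| = 2 &
      forall y, y \in L -> exists2 z, e y z & z \notin L.
    have := lower L; rewrite L2 => lowL.
    suff : gamma_rdR e + 2 + 0 <= 2 * gamma_rR e by lia.
    apply: lowL => y /HL[z yz zL]; split=> //; exists z => //.
    by rewrite zL g1.
  have wx' := neq_e _ _ wx; have uv' := neq_e _ _ uv.
  have pair a b a' b' : a != b -> e a a' -> e b b' -> a' != b -> b' != a ->
      exists2 L : {set T}, #|L| = 2 &
        forall y, y \in L -> exists2 z, e y z & z \notin L.
    move=> ab aa' bb' a'b b'a; exists [set a; b]; first by rewrite cards2 ab.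
    move=> y /set2P[]->; [exists a' | exists b'] => //;
      by rewrite !inE negb_or ?a'b ?b'a ?andbT //= eq_sym neq_e.
  have vu : e v u by rewrite e_sym.
  (* If [x = v], then [w] and [u] are the ends of a path through [v], which dominates both.
     Otherwise [w] keeps [x] and [v] keeps [u]; here [x = u] is allowed. *)
  case: (eqVneq x v) => [xv|xv].
    by apply: (pair w u x v); rewrite // ?xv eq_sym // eq_sym.
  by apply: (pair w v x u); rewrite // eq_sym.
(* Nothing is lowered here: each vertex of value 2 already saves 1, so equality forces exactly one
   such vertex. *)
have le1 : gamma_rdR e + #|level g 2| <= 2 * gamma_rR e.
  by have := lower set0; rewrite cards0 addn0; apply=> w; rewrite inE.
split; first by lia.
move=> eqg; right.
have /eqP/cards1P[h W2h] : #|level g 2| = 1 by lia.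
have g2 w : (g w == 2 :> nat) = (w == h).
  by have := in_set1 w h; rewrite -W2h inE.
have gh : g h = 2 :> nat by apply/eqP; rewrite g2.
(* Lowering [w] as well would bring the weight down to [2 * gamma_rR e - 2]. *)
have low1 w x : g w = 1 :> nat -> e w x -> 0 < g x -> False.
  move=> w1 wx x0; have := lower [set w]; rewrite cards1 W2h cards1 => low.
  suff : gamma_rdR e + 1 + 1 <= 2 * gamma_rR e by lia.
  apply: low => y /set1P->; split=> //; exists x => //.
  by rewrite inE x0 eq_sym neq_e.
have H0 w : g w = 0 :> nat -> e h w.
  case/(RRD_dominated Hg)=> x wx /eqP; rewrite g2 => /eqP xh.
  by rewrite e_sym -xh.
have N0 w : e h w = (g w == 0 :> nat).
  apply/idP/eqP=> [hw|/H0//].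
  have wh : w != h by rewrite eq_sym neq_e.
  have n1 : g w <> 1 :> nat.
    by move=> /(low1 _ h); rewrite e_sym hw gh; apply.
  by move: wh (g3 w); rewrite -g2; lia.
have NE : nbh e h = level g 0 by apply/setP=> w; rewrite !inE N0.
have wE : gamma_rR e = #|level g 1| + 2.
  transitivity (#|level g 1| + 2 * #|level g 2|); last by rewrite W2h cards1.
  rewrite -gE /weight -!sum_mem big_distrr -big_split /=.
  apply: eq_bigr => w _; rewrite !inE.
  by have := g3 w; case: (nat_of_ord (g w)) => [|[|[|]]].
exists h, (nbh e h), (level g 1); split=> //.
- split; rewrite ?inE ?e_irr ?gh //.
    by rewrite NE -setI_eq0; apply/eqP/setP=> w; rewrite !inE; case: eqP => // ->.
  apply/setP=> w; rewrite NE !inE -g2.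
  by have := g3 w; case: (nat_of_ord (g w)) => [|[|[|]]].
- by rewrite NE; case/andP: Hg.
- apply/forall_inP=> w; rewrite inE => /eqP w1.
  apply/forall_inP=> x; rewrite inE => /eqP x1.
  by apply/negP=> /(low1 _ _ w1); apply; rewrite x1.
split=> [r|]; first by rewrite inE N0 => /eqP->.
apply/negP=> /eqP NR.
(* Since [gamma_rR e] is [#|level g 1| + 2], this function has weight [2 * gamma_rR e - 2], which
   contradicts equality. *)
pose F w := if g w == 0 :> nat then 0 else 2.
have FE w : F w = 2 * (w \in level g 1) + 2 * (w \in level g 2).
  rewrite /F !inE.
  by have := g3 w; case: (nat_of_ord (g w)) => [|[|[|]]].
have F0 w : F w = 0 -> g w = 0 :> nat by rewrite /F; case: eqP.
suff : gamma_rdR e <= \sum_w F w.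
  under eq_bigr => w _ do rewrite FE.
  rewrite big_split -!big_distrr /= !sum_mem W2h cards1; lia.
apply: gamma_rdR_le => w.
- by rewrite /F; case: eqP.
(* The two neighbours of weight 2 are [h] and a vertex [r] of [level g 1], provided by the
   assumption that [nbhs] of that level covers [nbh e h]. *)
- move/F0=> w0; right.
  have : w \in nbh e h by rewrite NE inE w0.
  rewrite -NR inE => /andP[hw /bigcupP[r]]; rewrite !inE => /eqP r1 rw.
  rewrite inE in hw.
  exists h, r; rewrite e_sym hw e_sym rw /F gh r1; split=> //.
  by rewrite eq_sym -g2 r1.
- by rewrite /F; case: eqP.
- by case/F0/(RRD_restrained Hg) => x wx x0; exists x; rewrite // /F x0.
Qed.
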